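(* Let $(V,E)$ be an unrooted directed tree and let $\mu=(\mu_v)_{v\in V}$ be a weight on $V$. Let $X=\ell^p(V,\mu)$, $1\leq p<+\infty$, or $X=c_0(V,\mu)$, and suppose that the backward shift $B$ is a bounded operator on $X$. The following conditions are equivalent: (1) There exists a non-zero non-negative vector in $X$ whose orbit under $B$ has a nonzero limit point. (2) There exist a vertex $v\in V$ and a non-zero non-negative vector in $X$ whose orbit under $B$ has $e_v$ as a limit point. (3) There exist an increasing sequence $(n_k)_{k\in\mathbb{N}}$ of positive integers and a vertex $v\in V$ such that, as $k\to+\infty$, $$\begin{cases}\sum_{u\in\mathrm{Chi}^{n_k}(v)}\dfrac{1}{|\mu_u|^{p^\ast}}\longrightarrow+\infty & \text{if } X=\ell^p(V,\mu),\ 1<p<+\infty;\\[2mm] \inf_{u\in\mathrm{Chi}^{n_k}(v)}|\mu_u|\longrightarrow0 & \text{if } X=\ell^1(V,\mu);\\[2mm] \sum_{u\in\mathrm{Chi}^{n_k}(v)}\dfrac{1}{|\mu_u|}\longrightarrow+\infty & \text{if } X=c_0(V,\mu),\end{cases}$$ and, for every $i\in\mathbb{N}$, $$\mu_{\mathrm{par}^{n_k-n_i}(v)}\longrightarrow0\quad\text{as } k\to+\infty.$$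
   Context: $\mathbb{N}_0=\{0,1,2,\ldots\}$, $\mathbb{N}=\mathbb{N}_0\setminus\{0\}$, $\mathbb{K}$ is $\mathbb{R}$ or $\mathbb{C}$. Directed tree: a pair $(V,E)$ with $V$ a non-empty countable set (vertices) and $E\subset\{(u,v):u,v\in V,u\neq v\}$ (edges) such that: (i) any two distinct vertices are joined by an undirected path; (ii) there is no circuit, i.e. no sequence $v_1,\ldots,v_n$ of distinct vertices, $n\geq2$, with $(v_j,v_{j+1})\in E$ for $1\le j<n$ and $(v_n,v_1)\in E$; (iii) for each $v\in V$ there is at most one $u\in V$ with $(u,v)\in E$; if it exists it is called the parent of $v$, denoted $\mathrm{par}(v)$. A root is a vertex without parent; the tree is unrooted if it has no root, and then $\mathrm{par}^n(v)$ denotes the $n$-fold iterate of $\mathrm{par}$ at $v$ (in $\mathrm{par}^{n_k-n_i}(v)$ only $k\geq i$ is relevant). $\mathrm{Chi}(v)=\{u\in V:\mathrm{par}(u)=v\}$, $\mathrm{Chi}^1(v)=\mathrm{Chi}(v)$, $\mathrm{Chi}^n(v)=\bigcup_{u\in\mathrm{Chi}(v)}\mathrm{Chi}^{n-1}(u)$ for $n\geq2$. Weight on $V$: a family $\mu=(\mu_v)_{v\in V}$ of non-zero numbers in $\mathbb{K}$. $\ell^p(V,\mu)=\{f\in\mathbb{K}^V:\|f\|_{p,\mu}^p=\sum_{v}|f(v)\mu_v|^p<+\infty\}$ with norm $\|\cdot\|_{p,\mu}$; $c_0(V,\mu)$ is the set of $f\in\mathbb{K}^V$ such that for every $\varepsilon>0$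 there is a finite $F\subset V$ with $|f(v)\mu_v|<\varepsilon$ for all $v\in V\setminus F$, with norm $\sup_v|f(v)\mu_v|$. For $1<p<\infty$, $p^\ast=p/(p-1)$. $e_v$ is the characteristic function of $\{v\}$. The backward shift is $(Bf)(v)=\sum_{u\in\mathrm{Chi}(v)}f(u)$. An empty sum is $0$, the infimum of the empty set is $+\infty$; sums of non-negative numbers may equal $+\infty$. Increasing sequences of integers are strictly increasing. A vector $f\in X$ is non-negative if $f(v)\geq0$ for all $v\in V$. The orbit of $f$ under $B$ is the set $\{B^nf:n\in\mathbb{N}_0\}$; a limit point of the orbit is an accumulation point of this set for the norm topology of $X$. *)

(* Defs.v *)
From HB Require Import structures.
From mathcomp Require Export all_boot all_order all_algebra finmap.
From mathcomp Require Export complex.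
From mathcomp Require Export all_classical all_reals all_analysis.
From mathcomp.analysis.showcase Require summability.

Set Implicit Arguments.
Unset Strict Implicit.
Unset Printing Implicit Defensive.

Import Order.TTheory GRing.Theory Num.Theory.
Export numFieldNormedType.Exports.

Local Open Scope classical_set_scope.
Local Open Scope ring_scope.

Section DirectedTree.
Context {V : countType}.
Implicit Types (E : rel V) (u v : V).

Definition directed_tree E : Prop :=
  [/\ [set: V] !=set0,
      irreflexive E,
      forall u v, u != v ->
        exists s : seq V, path (fun x y => E x y || E y x) u s /\ last u s = v,
      forall s : seq V, (2 <= size s)%N -> uniq s -> ~~ cycle E s &
      forall u u' v, E u v -> E u' v -> u = u'].

Definition unrooted E : Prop := forall v, exists u, E u v.

(* The default value v is only taken at a root. *)
Definition par E v : V := xget v [set u | E u v].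

Definition Chi E v : set V := [set u | E v u].

(* Chi E is, up to propositional equality, the case n = 1. *)
Fixpoint Chin E (n : nat) v : set V :=
  if n is m.+1 then \bigcup_(u in Chi E v) Chin E m u else [set v].

End DirectedTree.

Variant scalar_kind := RealScalars | ComplexScalars.

Definition scalar (R : realType) (k : scalar_kind) : numFieldType :=
  match k with RealScalars => R | ComplexScalars => R[i] end.

(* The library's norm on R[i] takes its values in R[i]; this one is in R. *)
Definition modulus (R : realType) (k : scalar_kind) : scalar R k -> R :=
  match k with
  | RealScalars => fun x : R => `|x|
  | ComplexScalars => fun z : R[i] => ComplexField.Normc.normc z
  end.

Variant space_kind (R : realType) :=
  | ell (p : R) of 1 <= p
  | czero.

Section Shift.
Context {R : realType} {k : scalar_kind} {V : countType}.
Local Notation K := (scalar R k).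
Implicit Types (X : space_kind R) (E : rel V) (mu f g : V -> K).

Definition weight mu : Prop := forall v, mu v != 0.

Definition space_norm X mu f : \bar R :=
  match X with
  | ell p _ =>
      ((\esum_(v in [set: V]) (modulus (f v * mu v) `^ p)%:E) `^ p^-1)%E
  | czero => ereal_sup (range (fun v => (modulus (f v * mu v))%:E))
  end.

Definition in_space X mu f : Prop :=
  match X with
  | ell p _ => (\esum_(v in [set: V]) (modulus (f v * mu v) `^ p)%:E < +oo)%E
  | czero => forall e : R, 0 < e ->
      exists F : set V, finite_set F /\
        forall v, ~ F v -> modulus (f v * mu v) < e
  end.

(* Chi E v may be infinite: the sum defining (B f)(v) is the limit of the net
   of the sums of f over the finite subsets of Chi E v. *)
Definition child_sums E f v : {fset V} -> K :=
  summability.partial_sum (f \_ (Chi E v)).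

Definition shift E f : V -> K :=
  fun v => lim (child_sums E f v @ summability.totally).

Definition shift_bounded X E mu : Prop :=
  exists C : R, forall f, in_space X mu f ->
    [/\ forall v, cvg (child_sums E f v @ summability.totally),
        in_space X mu (shift E f) &
        (space_norm X mu (shift E f) <= C%:E * space_norm X mu f)%E].

Definition orbit E f : set (V -> K) := range (fun n => iter n (shift E) f).

Definition accumulation_point X mu (S : set (V -> K)) g : Prop :=
  in_space X mu g /\
  forall e : R, 0 < e ->
    exists h, [/\ h <> g, S h & (space_norm X mu (h - g)%R < e%:E)%E].

Definition nonnegative f : Prop := forall v, 0 <= f v.

(* The infimum over the empty set is +oo, as ereal_inf set0 = +oo. *)
Definition weight_condition X E mu (v : V) (n : nat -> nat) : Prop :=
  match X with
  | ell p _ =>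
      if p == 1 then
        ereal_inf [set (modulus (mu u))%:E | u in Chin E (n j) v]
          @[j --> \oo] --> 0%E
      else
        \esum_(u in Chin E (n j) v) ((modulus (mu u) `^ (p / (p - 1)))^-1)%:E
          @[j --> \oo] --> +oo%E
  | czero =>
      \esum_(u in Chin E (n j) v) ((modulus (mu u))^-1)%:E
        @[j --> \oo] --> +oo%E
  end.

End Shift.

(* Main.v *)
Require Import Defs.

Import Order.TTheory GRing.Theory Num.Theory.
Local Open Scope classical_set_scope.
Local Open Scope ring_scope.

(** For non-negative [f] one has [(B^n f)(v) = \sum_(u in Chi^n(v)) f u], the
    sets [Chi^n(v)] being disjoint for distinct [n].  If [B^(n_k) f] tends to
    [g] with [g v <> 0], the sum of [f] over [Chi^(n_k)(v)] stays away from [0]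
    while the norm of [f] restricted to [Chi^(n_k)(v)] tends to [0]: Young's
    inequality gives the first part of (3).  As [B^(n_k) f] at
    [par^(n_k - n_i)(v)] is at least [(B^(n_i) f)(v)], the second part follows.
    Conversely (3) provides, along a fast subsequence [N] of [n], finitely
    supported [phi_j >= 0] on [Chi^(N_j)(v)] of sum [1] and tiny norm; with
    [f = \sum_j phi_j], the pieces [j < k] contribute to [B^(N_k) f] the
    indicators of [par^(N_k - N_j)(v)], the piece [j = k] gives [e_v] and the
    remaining ones are negligible. *)

Set Implicit Arguments.
Unset Strict Implicit.
Unset Printing Implicit Defensive.

Lemma ler_sum_fset {R : realDomainType} {T : choiceType} (A B : {fset T})
    (F : T -> R) : (forall t, 0 <= F t) -> (A `<=` B)%fset ->
  \sum_(t <- A) F t <= \sum_(t <- B) F t.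
Proof.
move=> F0 AB; rewrite [leRHS](big_fsetID _ (mem A))/=.
rewrite (_ : [fset t in B | t \in A]%fset = A) ?lerDl ?sumr_ge0//.
by apply/fsetP => t; rewrite !inE/= andbC; case: (boolP (t \in A)) => //
  /(fsubsetP AB).
Qed.

(** * Real and complex scalars treated together through the real-valued modulus *)

Section Scalar.
Context {R : realType} {k : scalar_kind}.
Local Notation K := (scalar R k).
Implicit Types (x y : K) (r s : R).

Definition of_real : R -> K :=
  match k with
  | RealScalars => id
  | ComplexScalars => real_complex R
  end.

Lemma of_real_modulus x : of_real (modulus x) = `|x|.
Proof. by rewrite /of_real /modulus; move: x; rewrite /scalar; case: k. Qed.

Lemma of_realD r s : of_real (r + s) = of_real r + of_real s.
Proof. by rewrite /of_real /scalar; case: k => //; exact: rmorphD. Qed.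

Lemma of_realB r s : of_real (r - s) = of_real r - of_real s.
Proof. by apply/eqP; rewrite eq_sym subr_eq -of_realD subrK. Qed.

Lemma of_real0 : of_real 0 = 0.
Proof. by rewrite /of_real /scalar; case: k. Qed.

Lemma of_real1 : of_real 1 = 1.
Proof. by rewrite /of_real /scalar; case: k. Qed.

Lemma of_real_sum (I : Type) (s : seq I) (P : pred I) (F : I -> R) :
  of_real (\sum_(i <- s | P i) F i) = \sum_(i <- s | P i) of_real (F i).
Proof. exact: (big_morph _ of_realD of_real0). Qed.

Lemma ltr_of_real r s : (of_real r < of_real s) = (r < s).
Proof. by rewrite /of_real /scalar; case: k => //; exact: ltcR. Qed.

Lemma ler_of_real r s : (of_real r <= of_real s) = (r <= s).
Proof. by rewrite /of_real /scalar; case: k => //; exact: lecR. Qed.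

Lemma of_real_inj : injective of_real.
Proof. by move=> r s /eqP; rewrite eq_le !ler_of_real -eq_le => /eqP. Qed.

Lemma modulus_of_real r : modulus (of_real r) = `|r|.
Proof.
rewrite /modulus /of_real; case: k => //.
by rewrite -[LHS]/(Num.sqrt (r ^+ 2 + 0 ^+ 2)) expr0n addr0 sqrtr_sqr.
Qed.

Lemma of_real_modulus_ge0 x : 0 <= x -> of_real (modulus x) = x.
Proof. by move=> x0; rewrite of_real_modulus ger0_norm. Qed.

Lemma modulus_ge0 x : 0 <= modulus x.
Proof. by rewrite -ler_of_real of_real_modulus of_real0. Qed.

Lemma modulus0 : modulus (0 : K) = 0.
Proof. by apply: of_real_inj; rewrite of_real_modulus normr0 of_real0. Qed.

Lemma modulus_eq0 x : (modulus x == 0) = (x == 0).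
Proof.
by rewrite -(inj_eq of_real_inj) of_real_modulus of_real0 normr_eq0.
Qed.

Lemma modulus_gt0 x : (0 < modulus x) = (x != 0).
Proof. by rewrite lt_def modulus_ge0 andbT modulus_eq0. Qed.

Lemma modulusM x y : modulus (x * y) = modulus x * modulus y.
Proof.
rewrite /modulus; move: x y; rewrite /scalar; case: k => x y.
  exact: normrM.
exact: ComplexField.Normc.normcM.
Qed.

Lemma modulusN x : modulus (- x) = modulus x.
Proof. by apply: of_real_inj; rewrite !of_real_modulus normrN. Qed.

Lemma ler_modulusD x y : modulus (x + y) <= modulus x + modulus y.
Proof. by rewrite -ler_of_real of_realD !of_real_modulus ler_normD. Qed.

Lemma ler_modulusB x y : modulus x - modulus y <= modulus (x - y).
Proof. by rewrite lerBlDr -{1}(subrK y x) ler_modulusD. Qed.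

Lemma modulusB x y : modulus (x - y) = modulus (y - x).
Proof. by rewrite -modulusN opprB. Qed.

Lemma modulus_ltP x e : (modulus x < e) = (`|x| < of_real e).
Proof. by rewrite -ltr_of_real of_real_modulus. Qed.

(** A positive element of [K] is the image of a positive real, namely of its modulus, so real radii
    suffice to test convergence in [K]. *)
Lemma cvg_modulusP {T : Type} {F : set_system T} {FF : Filter F}
    (u : T -> K) (x : K) :
  u @ F --> x <-> forall e : R, 0 < e -> \forall t \near F, modulus (x - u t) <
    e.
Proof.
split=> [/cvgrPdist_lt ux e e0|ux].
  have /ux : (0 : K) < of_real e by rewrite -of_real0 ltr_of_real.
  by apply: filterS => t; rewrite modulus_ltP.
apply/cvgrPdist_lt => e e0.
have m0 : 0 < modulus e by rewrite modulus_gt0 gt_eqF.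
apply: filterS (ux _ m0) => t; rewrite modulus_ltP of_real_modulus_ge0//.
exact: ltW.
Qed.

End Scalar.

(** * The backward shift of a non-negative vector as a sum in the extended reals *)

Section ShiftSum.
#[local] Existing Instance summability.totally_filter.
Context {R : realType} {k : scalar_kind} {V : countType}.
Local Notation K := (scalar R k).
Implicit Types (E : rel V) (f : V -> K) (X : space_kind R).

(** The finite partial sums are images of non-negative reals that increase with the finite set;
    their limit is therefore real, non-negative and given by their supremum. *)
Lemma shift_sum E f v : nonnegative f ->
    cvg (child_sums E f v @ summability.totally) ->
  0 <= shift E f v /\
  (modulus (shift E f v))%:E = \esum_(u in Chi E v) (modulus (f u))%:E.
Proof.
move=> f0 cvf.
pose phi u := modulus ((f \_ (Chi E v)) u).
have phi0 u : 0 <= phi u by exact: modulus_ge0.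
have sumE (A : {fset V}) : child_sums E f v A = of_real (\sum_(u <- A) phi u).
  rewrite /child_sums /summability.partial_sum of_real_sum big_seq_fsetE/=.
  apply: eq_bigr => u _; rewrite /phi of_real_modulus_ge0//.
  by rewrite patchE; case: ifP.
have /cvg_modulusP cvS : child_sums E f v @ summability.totally --> shift E f v.
  exact: cvf.
have near_sum (e : R) : 0 < e -> exists A : {fset V}, forall B : {fset V},
    (A `<=` B)%fset ->
    modulus (shift E f v - of_real (\sum_(u <- B) phi u)) < e.
  by move=> /cvS[A _ AP]; exists A => B /AP; rewrite /= sumE.
have sum0 (A : {fset V}) : 0 <= \sum_(u <- A) phi u by apply: sumr_ge0.
set S := shift E f v in near_sum *.
have nearS (e : R) : 0 < e -> exists A : {fset V}, forall B : {fset V},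
    (A `<=` B)%fset -> `|modulus S - \sum_(u <- B) phi u| < e.
  move=> /near_sum[A AP]; exists A => B /AP; apply: le_lt_trans.
  rewrite -[X in `|_ - X|](ger0_norm (sum0 B)) -[X in `|_ - X|](modulus_of_real
    (k := k)).
  by rewrite ler_norml ler_modulusB andbT modulusB lerNl opprB ler_modulusB.
split.
  (* That [S] is real is seen by comparing both [S] and its modulus with one partial sum, over a
     finite set beyond the two thresholds [A] and [B]. *)
  suff -> : S = of_real (modulus S) by rewrite of_real_modulus.
  apply/eqP; rewrite -subr_eq0 -modulus_eq0 eq_le modulus_ge0 andbT.
  apply/ler_addgt0Pr => e e0; rewrite add0r.
  have e20 : 0 < e / 2 by rewrite divr_gt0.
  have [A AP] := near_sum _ e20; have [B BP] := nearS _ e20.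
  have := AP (A `|` B)%fset (fsubsetUl _ _).
  have := BP (A `|` B)%fset (fsubsetUr _ _).
  set s := \sum_(u <- _) _ => sl sr.
  have -> : S - of_real (modulus S) = (S - of_real s) + of_real (s - modulus S).
    by rewrite of_realB addrA subrK.
  apply: le_trans (ler_modulusD _ _) _; rewrite modulus_of_real distrC.
  by rewrite [leRHS]splitr lerD// ltW.
rewrite esum_mkcond; apply/eqP; rewrite eq_le; apply/andP; split.
  apply/lee_addgt0Pr => e e0; have [A AP] := nearS _ e0.
  rewrite -leeBlDr//; apply: esum_ge; exists [set` A]; first by split.
  have := AP A (fsubset_refl _); rewrite ltr_distl => /andP[_ /ltW].
  rewrite -lerBlDr -EFinB => SA.
  rewrite fsbig_finite//= set_fsetK.
  rewrite (eq_bigr (fun u => (phi u)%:E)) ?sumEFin// => u _.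
  by rewrite /phi patchE; case: ifP => //; rewrite modulus0.
apply: ge_ereal_sup => _ [F [finF _] <-].
apply/lee_addgt0Pr => e e0; have [A AP] := nearS _ e0.
have := AP (A `|` fset_set F)%fset (fsubsetUl _ _).
rewrite ltr_distlC => /andP[_ /ltW] SA.
rewrite fsbig_finite//= (eq_bigr (fun u => (phi u)%:E)) => [|u _]; last first.
  by rewrite /phi patchE; case: ifP => //; rewrite modulus0.
rewrite sumEFin -EFinD lee_fin; apply: le_trans SA.
by apply: ler_sum_fset => //; exact: fsubsetUr.
Qed.

End ShiftSum.

(** * Ancestors and generations in an unrooted directed tree *)

Section Tree.
Context {V : countType} {E : rel V}.
Hypotheses (treeE : directed_tree E) (unrootedE : unrooted E).
Implicit Types (u v w : V).

Lemma edge_par v : E (par E v) v.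
Proof.
have [u Euv] := unrootedE v.
exact: (@xgetPex _ v [set u | E u v] (ex_intro _ u Euv)).
Qed.

Lemma edgeE u v : E u v <-> par E v = u.
Proof.
case: treeE => _ _ _ _ uniq_par.
by split=> [Euv|<-]; [exact: uniq_par (edge_par v) Euv|exact: edge_par].
Qed.

Lemma ChinE n v : Chin E n v = [set u | iter n (par E) u = v].
Proof.
elim: n v => [|n IH] v //=; apply/seteqP; split => [u [w]|u /= uv].
  by rewrite IH => /edgeE <- /= <-.
by exists (iter n (par E) u); [apply/edgeE|rewrite IH].
Qed.

(** A shortest return of [v] to itself under [par] runs through distinct vertices, at least two
    since no edge is a loop; read backwards it is a circuit. *)
Lemma iter_par_neq n v : iter n.+1 (par E) v <> v.
Proof.
case: treeE => _ Eirr _ Eacyclic _.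
pose P m := iter m.+1 (par E) v == v.
move=> nv; have : exists m, P m by exists n; apply/eqP.
case/ex_minnP => m /eqP mv m_min.
pose s := traject (par E) v m.+1.
have m0 : (0 < m)%N.
  case: m mv {m_min s} => // pv; have := edge_par v.
  by rewrite [par E v]pv Eirr.
have us : uniq s.
  rewrite looping_uniq; apply/negP => /trajectP[i im vi].
  suff : P i by move=> /m_min; rewrite leqNgt im.
  by rewrite /P iterS -vi -iterS mv.
apply: (negP (Eacyclic (rev s) _ _)); rewrite ?rev_uniq ?size_rev
  ?size_traject//.
rewrite rev_cycle.
have : fpath (par E) v (traject (par E) (par E v) m.+1) by exact: fpath_traject.
rewrite trajectSr -iterSr mv => fp.
by apply: sub_path fp => x y /= /eqP <-; exact: edge_par.
Qed.

(** Two coinciding ancestors would give a vertex that returns to itself. Hence the generations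
    [Chin E n v] are disjoint for distinct [n]. *)
Lemma iter_par_inj v : injective (fun n => iter n (par E) v).
Proof.
move=> m n; wlog mn : m n / (m <= n)%N.
  by move=> W; case: (leqP m n) => [/W//|/ltnW/W + /esym] => /[apply].
rewrite -(subnKC mn) addnC iterD; case: (n - m)%N => [//|d] /esym dE.
by have := @iter_par_neq d (iter m (par E) v).
Qed.

(** Each [u] on the left passes through exactly one child of [v], namely [iter n (par E) u], which
    reindexes the double sum by [u] alone. *)
Lemma esum_Chi_Chin {R : realType} (a : V -> \bar R) n v :
    (forall u, 0 <= a u)%E ->
  \esum_(u in Chin E n.+1 v) a u =
  \esum_(w in Chi E v) \esum_(u in Chin E n w) a u.
Proof.
move=> a0; rewrite esum_esum//.
rewrite (reindex_esum (Chin E n.+1 v) _ (fun u => (iter n (par E) u, u)))//.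
split=> [u|u u' _ _ []//|[w u] /= [wv]]; rewrite !ChinE/=.
  by move=> uv; split; [exact/edgeE|rewrite /= ChinE].
move=> uw; exists u; last by rewrite uw.
by exists w => //; rewrite ChinE.
Qed.

End Tree.

(** * Iterates of the shift on non-negative vectors *)

Section IteratedShift.
Context {R : realType} {k : scalar_kind} {V : countType}.
Context {E : rel V} {mu : V -> scalar R k} {X : space_kind R}.
Hypotheses (treeE : directed_tree E) (unrootedE : unrooted E).
Hypothesis (B_bounded : shift_bounded X E mu).
Local Notation B := (shift E).

Lemma in_space_iter_shift f n :
  in_space X mu f -> in_space X mu (iter n B f).
Proof. by move=> fX; elim: n => //= n; case: B_bounded => C /[apply] -[]. Qed.

(** By induction: boundedness of the shift supplies convergence at each stage, and non-negativity
    allows regrouping by generations. *)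
Lemma iter_shift_sum f n : in_space X mu f -> nonnegative f ->
  nonnegative (iter n B f) /\
  forall v, (modulus (iter n B f v))%:E =
    \esum_(u in Chin E n v) (modulus (f u))%:E.
Proof.
move=> fX f0; elim: n => [|n [IH0 IH]].
  by split=> // v; rewrite esum_set1// lee_fin modulus_ge0.
have cv v : cvg (child_sums E (iter n B f) v @ summability.totally).
  by case: B_bounded => C /(_ _ (in_space_iter_shift n fX))[].
split=> v; have [S0 SE] := shift_sum IH0 (cv v) => //.
rewrite iterS SE (esum_Chi_Chin treeE)//; first exact: eq_esum.
by move=> u; rewrite lee_fin modulus_ge0.
Qed.

(** A descendant of [v] at distance [n] is one of [iter m (par E) v] at distance [m + n], so the
    right side sums over a larger set. *)
Lemma iter_shift_ge f m n v : in_space X mu f -> nonnegative f ->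
  modulus (iter n B f v) <=
  modulus (iter (m + n) B f (iter m (par E) v)).
Proof.
move=> fX f0; rewrite -lee_fin !(iter_shift_sum _ fX f0).2.
apply: ereal_sup_le => _ [A [finA An] <-].
exists A => //.
split=> // u /An; rewrite !ChinE//= => <-.
by rewrite iterD.
Qed.

End IteratedShift.

(** * The power function behind the norm *)

Section Gauge.
Context {R : realType} (X : space_kind R).
Implicit Types x y : R.

(** It lets both families of spaces share the same estimates: [gauge] is increasing and
    multiplicative on non-negative reals, and additive up to a constant. *)
Definition gauge x : R := if X is ell p _ then x `^ p else x.

Lemma gauge0 : gauge 0 = 0.
Proof.
by rewrite /gauge; case: X => // p p1; rewrite powR0 ?gt_eqF// (lt_le_trans _
  p1).
Qed.

Lemma ler_gauge x y : 0 <= x -> x <= y -> gauge x <= gauge y.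
Proof.
rewrite /gauge; case: X => // p p1 x0 xy.
by apply: ge0_ler_powR; rewrite ?nnegrE// ?(le_trans _ p1)// (le_trans x0).
Qed.

Lemma ltr_gauge x y : 0 <= x -> x < y -> gauge x < gauge y.
Proof.
rewrite /gauge; case: X => // p p1 x0 xy.
apply: gt0_ltr_powR; rewrite ?nnegrE// ?(lt_le_trans _ p1)//.
by rewrite (le_trans x0)// ltW.
Qed.

Lemma gauge_ge0 x : 0 <= x -> 0 <= gauge x.
Proof. by move=> x0; rewrite -gauge0 ler_gauge. Qed.

Lemma gauge_gt0 x : 0 < x -> 0 < gauge x.
Proof. by move=> x0; rewrite -gauge0 ltr_gauge. Qed.

Lemma gaugeM x y : 0 <= x -> 0 <= y -> gauge (x * y) = gauge x * gauge y.
Proof. by rewrite /gauge; case: X => // p _ x0 y0; rewrite powRM. Qed.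

Lemma gauge_surj y : 0 < y -> exists2 x, 0 < x & gauge x = y.
Proof.
rewrite /gauge; case: X => [p p1|] y0; last by exists y.
have p0 : p != 0 by rewrite gt_eqF// (lt_le_trans _ p1).
exists (y `^ p^-1); first exact: powR_gt0.
by rewrite -powRrM mulVf// powRr1// ltW.
Qed.

Lemma ltr_gaugeP x y : 0 <= x -> 0 <= y -> (gauge x < gauge y) = (x < y).
Proof.
move=> x0 y0; apply/idP/idP => [|/ltr_gauge -> //].
by apply: contraTT; rewrite -!leNgt => /ler_gauge ->.
Qed.

(** The sum [x + y] is at most twice the larger term, and [gauge] is multiplicative. *)
Lemma gaugeD x y : 0 <= x -> 0 <= y ->
  gauge (x + y) <= gauge 2 * (gauge x + gauge y).
Proof.
move=> x0 y0; wlog xy : x y x0 y0 / x <= y.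
  move=> W; have [/W->//|/ltW/W] := leP x y.
  by rewrite [y + x]addrC [gauge y + _]addrC => ->.
rewrite (@le_trans _ _ (gauge (2 * y)))//.
  by rewrite ler_gauge ?addr_ge0// mulr_natl mulr2n lerD.
by rewrite gaugeM// ler_wpM2l ?gauge_ge0// lerDr gauge_ge0.
Qed.

End Gauge.

(** * The mass of a non-negative function *)

Section Mass.
Context {R : realType} {V : choiceType} (X : space_kind R).
Implicit Types (a b : V -> R) (A : set V).

(* The p-th power of the norm in the case of [ell p]; unlike the norm, it is
   countably additive over disjoint supports. *)
Definition mass a : \bar R :=
  if X is ell p _ then \esum_(v in [set: V]) (gauge X (a v))%:E
  else ereal_sup (range (fun v => (gauge X (a v))%:E)).

Lemma gauge_le_mass a v : (forall v, 0 <= a v) -> ((gauge X (a v))%:E <= mass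
  a)%E.
Proof.
move=> a0; rewrite /mass; case: X => [p p1|].
  by apply: esum_ge; exists [set v]; [split|rewrite fsbig_set1].
by apply: ereal_sup_ubound; exists v.
Qed.

Lemma le_mass a b : (forall v, 0 <= a v) -> (forall v, a v <= b v) ->
  (mass a <= mass b)%E.
Proof.
move=> a0 ab; have ab' v : ((gauge X (a v))%:E <= (gauge X (b v))%:E)%E.
  by rewrite lee_fin ler_gauge.
rewrite /mass; case: X ab' => [p p1|] ab'; first exact: le_esum.
apply: ge_ereal_sup => _ [v _ <-]; apply: le_trans (ab' v) _.
by apply: ereal_sup_ubound; exists v.
Qed.

(** This replaces the triangle inequality, at the price of the constant [gauge X 2]. *)
Lemma massD a b : (forall v, 0 <= a v) -> (forall v, 0 <= b v) ->
  (mass (fun v => (a v + b v)%R) <= (gauge X 2)%:E * (mass a + mass b))%E.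
Proof.
move=> a0 b0.
have ab v : ((gauge X (a v + b v))%:E <=
    (gauge X 2)%:E * ((gauge X (a v))%:E + (gauge X (b v))%:E))%E.
  by rewrite -EFinD -EFinM lee_fin gaugeD.
have am v := gauge_le_mass v a0; have bm v := gauge_le_mass v b0.
have g2 : 0 <= gauge X 2 by exact: gauge_ge0.
move: am bm ab g2; rewrite /mass; case: X => [p p1|] am bm ab g2.
  rewrite -esumD//; last 2 first.
  - by move=> v _; rewrite lee_fin powR_ge0.
  - by move=> v _; rewrite lee_fin powR_ge0.
  apply: ge_ereal_sup => _ [F [finF _] <-].
  apply: (@le_trans _ _ (\sum_(v \in F) ((gauge (ell p1) 2)%:E *
     ((gauge (ell p1) (a v))%:E + (gauge (ell p1) (b v))%:E)))%E).
    by apply: lee_fsum.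
  rewrite fsbig_finite//= -ge0_sume_distrr//; last first.
    by move=> v _; rewrite -EFinD lee_fin addr_ge0 ?powR_ge0.
  rewrite lee_wpmul2l ?lee_fin//; apply: esum_ge; exists F; first by split.
  by rewrite fsbig_finite.
apply: ge_ereal_sup => _ [v _ <-]; apply: le_trans (ab v) _.
by rewrite lee_wpmul2l ?lee_fin// leeD.
Qed.

(** The gauge of [a] is dominated pointwise by the series of the gauges of the [b j]. Exchanging
    sums, or bounding the supremum termwise, leaves a geometric series of sum [e]; no constant of
    [massD] accumulates. *)
Lemma mass_series a (b : nat -> V -> R) (e : R) : 0 <= e ->
    (forall v, 0 <= a v) -> (forall j v, 0 <= b j v) ->
    (forall v, a v = 0 \/ exists j, a v <= b j v) ->
    (forall j, (mass (b j) <= (e / (2 ^ j.+1)%:R)%:E)%E) ->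
  (mass a <= e%:E)%E.
Proof.
move=> e0 a0 b0 ab be.
apply: le_trans (epsilon_trick0 xpredT e0).
have gb0 j v : (0 <= (gauge X (b j v))%:E)%E by rewrite lee_fin gauge_ge0.
have gab v : ((gauge X (a v))%:E <= \sum_(j <oo) (gauge X (b j v))%:E)%E.
  have [->|[j aj]] := ab v; first by rewrite gauge0 nneseries_ge0.
  rewrite (@le_trans _ _ (gauge X (b j v))%:E)//;
    first by rewrite lee_fin ler_gauge.
  rewrite (le_trans _ (nneseries_lim_ge j.+1 _))//.
  by rewrite big_nat_recr//= leeDr// sume_ge0.
have bm j v := gauge_le_mass v (b0 j).
move: be gb0 gab bm; rewrite /mass; case: X => [p p1|] be gb0 gab bm.
  apply: le_trans (le_esum (fun v _ => gab v)) _.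
  under eq_esum do rewrite nneseries_esumT//.
  rewrite esum_esum//=.
  rewrite (reindex_esum ([set: nat] `*`` fun=> [set: V]) _ (fun x => (x.2,
    x.1)))/=.
    rewrite -(esum_esum (I := [set: nat]) (J := fun=> [set: V])
      (a := fun j v => (gauge (ell p1) (b j v))%:E))//.
    rewrite -nneseries_esumT; last by move=> j; apply: esum_ge0 => v _.
    apply: lee_nneseries => [j _ _|j _]; last exact: be.
    by apply: esum_ge0.
  by split=> [//|[i j] [i' j'] _ _ [-> ->]//|[i j] _]; exists (j, i).
  by move=> v j _ _; exact: gb0.
apply: ge_ereal_sup => _ [v _ <-]; apply: le_trans (gab v) _.
apply: lee_nneseries => // j _.
exact: le_trans (bm j v) (be j).
Qed.

End Mass.

(** * Norm, membership and boundedness expressed through the mass *)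

Section NormMass.
Context {R : realType} {k : scalar_kind} {V : countType}.
Context (X : space_kind R) (E : rel V) (mu : V -> scalar R k).
Implicit Types (f : V -> scalar R k).

Definition weighted f v : R := modulus (f v * mu v).

Lemma weighted_ge0 f v : 0 <= weighted f v.
Proof. exact: modulus_ge0. Qed.

Lemma ltr_space_norm f (e : R) : 0 < e ->
  (space_norm X mu f < e%:E)%E = (mass X (weighted f) < (gauge X e)%:E)%E.
Proof.
move=> e0; rewrite /space_norm /mass /gauge; case: X => [p p1|//].
have p0 : 0 < p by exact: lt_le_trans p1.
set S := esum _ _; have S0 : (0 <= S)%E.
  by apply: esum_ge0 => v _; rewrite lee_fin powR_ge0.
have Sp : ((S `^ p^-1) `^ p = S)%E by rewrite -poweRrM mulVf ?gt_eqF// poweRe1.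
have ep : (e `^ p) `^ p^-1 = e by rewrite -powRrM divff ?gt_eqF// powRr1// ltW.
rewrite ltNge [RHS]ltNge; congr (~~ _); apply/idP/idP => eS.
  rewrite -Sp -poweR_EFin; apply: gt0_ler_poweR => //; first exact: ltW.
    by rewrite in_itv/= lee_fin ltW// leey.
  by rewrite in_itv/= poweR_ge0 leey.
rewrite -ep -poweR_EFin; apply: gt0_ler_poweR => //;
  first by rewrite invr_ge0 ltW.
  by rewrite in_itv/= lee_fin powR_ge0 leey.
by rewrite in_itv/= S0 leey.
Qed.

Lemma mass_shift : shift_bounded X E mu -> exists2 C : R, 1 <= C &
  forall f, in_space X mu f ->
    (mass X (weighted (shift E f)) <= C%:E * mass X (weighted f))%E.
Proof.
(* The given bound may be below 1 or negative; after taking the maximum, all powers of the new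
   constant are at least 1. *)
case=> C BC; exists (gauge X (Num.max 1 C)).
  rewrite -[leLHS](_ : gauge X 1 = 1); last by rewrite /gauge;
    case: X => // p _; rewrite powR1.
  by rewrite ler_gauge// le_max lexx.
move=> f /BC[_ _]; rewrite /space_norm /mass /gauge; case: X => [p p1|].
  have p0 : 0 < p by exact: lt_le_trans p1.
  set S := esum _ _; set S' := esum _ _.
  have S0 : (0 <= S)%E by apply: esum_ge0 => v _; rewrite lee_fin powR_ge0.
  have S'0 : (0 <= S')%E by apply: esum_ge0 => v _; rewrite lee_fin powR_ge0.
  have powK (x : \bar R) : (0 <= x -> (x `^ p^-1) `^ p = x)%E.
    by move=> x0; rewrite -poweRrM mulVf ?gt_eqF// poweRe1.
  move=> SS'.
  have {}SS' : (S `^ p^-1 <= (Num.max 1 C)%:E * S' `^ p^-1)%E.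
    apply: le_trans SS' _; rewrite lee_wpmul2r ?poweR_ge0// lee_fin.
    by rewrite le_max lexx orbT.
  rewrite -{1}(powK _ S0) -{1}(powK _ S'0) -poweR_EFin -poweRM ?poweR_ge0//;
    last first.
    by rewrite lee_fin le_max ler01.
  apply: gt0_ler_poweR => //; first exact: ltW.
    by rewrite in_itv/= poweR_ge0 leey.
  by rewrite in_itv/= mule_ge0 ?leey ?poweR_ge0// lee_fin le_max ler01.
(* For [czero] the supremum over an empty [V] is [-oo]; a vertex makes it non-negative, so that [C]
   may be enlarged. *)
move=> SS'; have [[v _]|V0] := pselect ([set: V] !=set0); last first.
  have range0 (g : V -> \bar R) : range g = set0.
    by rewrite -subset0 => y [v _ _]; case: V0; exists v.
  by rewrite range0 ereal_sup0 leNye.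
apply: le_trans SS' _; rewrite lee_wpmul2r//; last first.
  by rewrite lee_fin le_max lexx orbT.
apply: (@le_trans _ _ (weighted f v)%:E); first by rewrite lee_fin weighted_ge0.
by apply: ereal_sup_ubound; exists v.
Qed.

(** A convergent series has small tails, and a finite sum plus a tail below 1 is finite. For
    [czero], passing to [e / 2] keeps the supremum strictly below [e]. *)
Lemma in_spaceP f : in_space X mu f <-> forall e : R, 0 < e ->
  exists F : {fset V}, (mass X (weighted f \_ (~` [set` F])) < e%:E)%E.
Proof.
rewrite /in_space /mass; case: X => [p p1|].
  have p0 : 0 < p by exact: lt_le_trans p1.
  have patchE (A : set V) : \esum_(v in [set: V])
      (gauge (ell p1) ((weighted f \_ A) v))%:E =
      \esum_(v in A) (modulus (f v * mu v) `^ p)%:E.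
    rewrite [RHS]esum_mkcond; apply: eq_esum => v _; rewrite patchE.
    by case: ifP => //; rewrite gauge0.
  have split_sum (F : {fset V}) :
      \esum_(v in [set: V]) (modulus (f v * mu v) `^ p)%:E =
      (\sum_(v \in [set` F]) (modulus (f v * mu v) `^ p)%:E +
       \esum_(v in ~` [set` F]) (modulus (f v * mu v) `^ p)%:E)%E.
    rewrite (esumID [set` F]); last by move=> v _; rewrite lee_fin powR_ge0.
    rewrite !setTI -esum_fset// => v _.
    by rewrite lee_fin powR_ge0.
  split=> [fX e e0|/(_ 1 ltr01)[F]].
    set S := esum _ _ in fX.
    have Sfin : S \is a fin_num.
      by rewrite ge0_fin_numE// esum_ge0// => v _; rewrite lee_fin powR_ge0.
    have : (S - e%:E < S)%E by rewrite lteBlDr// lteDl// lte_fin.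
    case/ereal_sup_gt => _ [F [finF _] <-] SF.
    exists (fset_set F); rewrite patchE fset_setK//.
    move: SF; rewrite lteBlDr// /S (split_sum (fset_set F)) fset_setK//.
    by rewrite lteD2lE// fsbig_finite//= sumEFin.
  rewrite patchE (split_sum F) => F1; rewrite lte_add_pinfty//.
    by rewrite fsbig_finite//= sumEFin ltry.
  by rewrite (lt_le_trans F1) ?leey.
split=> [fX e e0|fX e e0].
  have [|F [finF Fe]] := fX (e / 2); first by rewrite divr_gt0.
  exists (fset_set F); rewrite fset_setK//.
  rewrite (@le_lt_trans _ _ (e / 2)%:E) ?lte_fin ?ltr_pdivrMr ?ltr_pMr ?ltr1n//.
  apply: ge_ereal_sup => _ [v _ <-]; rewrite lee_fin /gauge patchE.
  case: ifPn => [|_]; first by rewrite inE => /Fe/ltW.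
  by rewrite divr_ge0// ltW.
have [F Fe] := fX e e0; exists [set` F]; split=> // v vF.
rewrite -lte_fin; apply: le_lt_trans Fe; apply: ereal_sup_ubound.
by exists v => //; rewrite /gauge patchE ifT// inE.
Qed.

(** The sets [Q j] eventually avoid any given finite set, and outside a suitable one the mass of [f]
    is already small. *)
Lemma mass_tail f (Q : nat -> set V) : in_space X mu f ->
    (forall u, \forall j \near \oo, ~ Q j u) ->
  forall e : R, 0 < e -> \forall j \near \oo, (mass X (weighted f \_ (Q j)) <
    e%:E)%E.
Proof.
move=> /in_spaceP fX QP e /fX[F Fe].
have : \forall j \near \oo, forall u, u \in (F : seq V) -> ~ Q j u.
  elim: (F : seq V) => [|u s IH]; first by near=> j.
  near=> j => w; rewrite inE => /orP[/eqP ->|]; first by near: j; exact: QP.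
  by move: w; near: j.
apply: filterS => j jF; apply: le_lt_trans Fe; apply: le_mass => v.
  by rewrite patchE; case: ifP => // _; exact: weighted_ge0.
rewrite !patchE; case: ifPn; last by case: ifP => // _ _; exact: weighted_ge0.
by rewrite inE => Qv; rewrite ifT// inE => /= vF; exact: jF Qv.
Unshelve. all: by end_near. Qed.

End NormMass.

(** * Auxiliary inequalities and limits in the extended reals *)

Lemma le_esumZl {R : realType} {T : choiceType} (S : set T) (c : R)
    (a : T -> R) : 0 <= c -> (forall t, 0 <= a t) ->
  (\esum_(t in S) (c * a t)%:E <= c%:E * \esum_(t in S) (a t)%:E)%E.
Proof.
move=> c0 a0; apply: ge_ereal_sup => _ [F [finF FS] <-].
rewrite fsbig_finite//= (eq_bigr (fun t => c%:E * (a t)%:E)%E)//.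
rewrite -ge0_sume_distrr; last by move=> t _; rewrite lee_fin.
rewrite lee_wpmul2l ?lee_fin//; apply: esum_ge; exists F => //.
by rewrite fsbig_finite.
Qed.

(** The factors [1 / p] and [1 / q] of Young's inequality are at most 1 and are dropped. *)
Lemma Young_le {R : realType} (a b p : R) : 0 <= a -> 0 <= b -> 1 < p ->
  a * b <= a `^ p + b `^ (p / (p - 1)).
Proof.
move=> a0 b0 p1; have p0 : 0 < p by exact: lt_trans p1.
have p10 : 0 < p - 1 by rewrite subr_gt0.
have q0 : 0 < p / (p - 1) by rewrite divr_gt0.
apply: le_trans (conjugate_powR a0 b0 p0 q0 _) _.
  by rewrite invf_div -{1}[p^-1]mul1r -mulrDl subrKC divff// gt_eqF.
by apply: lerD; apply: ler_piMr; rewrite ?powR_ge0// invf_le1// ?ler_pdivlMr//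
  ?mul1r ?gerBl ltW.
Qed.

Lemma cvge0P {R : realType} (u : nat -> \bar R) : (forall j, (0 <= u j)%E) ->
  u j @[j --> \oo] --> 0%E <->
  forall e : R, 0 < e -> \forall j \near \oo, (u j < e%:E)%E.
Proof.
move=> u0; split=> [/fine_cvgP[ufin /cvgr0Pnorm_lt u_lt] e e0|ue].
  have := u_lt _ e0; apply: filterS2 ufin => j /fineK <-; rewrite lte_fin.
  exact: le_lt_trans (ler_norm _).
apply/fine_cvgP; split.
  apply: filterS (ue _ ltr01) => j uj; rewrite ge0_fin_numE//.
  by rewrite (lt_le_trans uj) ?leey.
apply/cvgr0Pnorm_lt => e e0; apply: filterS (ue _ e0) => j uj /=.
rewrite ger0_norm ?fine_ge0// -lte_fin fineK// ge0_fin_numE//.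
by rewrite (lt_le_trans uj) ?leey.
Qed.

Lemma cvgey_pos {R : realType} (u : nat -> \bar R) :
  (forall M : R, 0 < M -> \forall j \near \oo, (M%:E <= u j)%E) ->
  u j @[j --> \oo] --> +oo%E.
Proof.
move=> uM; apply/cvgeyPge => M.
have M0 : 0 < Num.max 1 M by rewrite lt_max ltr01.
apply: filterS (uM _ M0) => j; apply: le_trans.
by rewrite lee_fin le_max lexx orbT.
Qed.

(** * The weight condition and its dual vectors *)

Section WeightCondition.
Context {R : realType} {k : scalar_kind} {V : countType}.
Context {X : space_kind R} {E : rel V} {mu : V -> scalar R k}.
Hypothesis mu_weight : weight mu.
Local Notation m v := (modulus (mu v)).

Let m_gt0 v : 0 < m v.
Proof. by rewrite modulus_gt0. Qed.

Let patch_esum p (p1 : 1 <= p) (a : V -> R) S :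
  mass (ell p1) (a \_ S) = \esum_(u in S) (a u `^ p)%:E.
Proof.
rewrite [RHS]esum_mkcond; apply: eq_esum => u _; rewrite patchE.
by case: ifP => // _; rewrite gauge0.
Qed.

(** The modulus of [f u] is its weighted value times the inverse weight. Were the weights on the
    wrong side of the threshold at a late [j], the sum of [f] would drop below [c]: by supremum
    against sum for [czero], by sum against the largest inverse weight for [p = 1], by Young's
    inequality otherwise. *)
Lemma weight_conditionI (f : V -> scalar R k) v (n : nat -> nat) (c : R) :
    0 < c ->
    (forall j, (c%:E <= \esum_(u in Chin E (n j) v) (modulus (f u))%:E)%E) ->
    (forall e : R, 0 < e -> \forall j \near \oo,
      (mass X (weighted mu f \_ (Chin E (n j) v)) < e%:E)%E) ->
  weight_condition X E mu v n.
Proof.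
move=> c0 fc fe.
have fE u : modulus (f u) = weighted mu f u * (m u)^-1.
  by rewrite /weighted modulusM mulfK// modulus_eq0.
case: X fe => [p p1|] fe /=; last first.
  apply: cvgey_pos => M M0; have cM0 : 0 < c / M by rewrite divr_gt0.
  apply: filterS (fe _ cM0) => j mass_lt; rewrite leNgt; apply/negP => SM.
  have := fc j; apply/negP; rewrite -ltNge.
  apply: (@le_lt_trans _ _ (\esum_(u in Chin E (n j) v) ((c / M) * (m
    u)^-1)%:E)).
    apply: le_esum => u uS; rewrite lee_fin fE ler_wpM2r ?invr_ge0 ?ltW//.
    rewrite -lte_fin; apply: le_lt_trans mass_lt.
    apply: ereal_sup_ubound; exists u => //; rewrite /gauge patchE ifT//.
    exact/mem_set.
  apply: le_lt_trans (le_esumZl _ (ltW cM0) _) _.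
    by move=> u; rewrite invr_ge0 ltW.
  by rewrite -[ltRHS](_ : (c / M)%:E * M%:E = c%:E)%E ?lte_pmul2l// -EFinM
    divfK ?gt_eqF.
have massE := patch_esum p1 (weighted mu f).
case: ifPn => [/eqP p_eq1|p_neq1].
  apply/cvge0P => [j|e e0].
    by apply: le_ereal_inf_tmp => _ [u _ <-]; rewrite lee_fin modulus_ge0.
  have ce0 : 0 < c * e by rewrite mulr_gt0.
  apply: filterS (fe _ ce0) => j; rewrite massE => mass_lt.
  rewrite ltNge; apply/negP => inf_ge.
  have := fc j; apply/negP; rewrite -ltNge.
  apply: (@le_lt_trans _ _ (\esum_(u in Chin E (n j) v) (e^-1 * weighted mu f u
    `^ p)%:E)).
    apply: le_esum => u uS; rewrite lee_fin fE p_eq1 powRr1 ?weighted_ge0//.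
    rewrite mulrC ler_wpM2r ?weighted_ge0// lef_pV2 ?posrE//.
    by rewrite -lee_fin (le_trans inf_ge)//; apply: ereal_inf_lbound; exists u.
  apply: le_lt_trans (le_esumZl _ _ _) _; rewrite ?invr_ge0 ?(ltW e0)//.
    by move=> u; rewrite powR_ge0.
  rewrite -[ltRHS](_ : e^-1%:E * (c * e)%:E = c%:E)%E.
    by rewrite lte_pmul2l// lte_fin invr_gt0.
  by rewrite -EFinM mulrC mulfK ?gt_eqF.
have {}p_gt1 : 1 < p by rewrite lt_def p_neq1.
set q := p / (p - 1).
have q0 : 0 < q by rewrite divr_gt0 ?subr_gt0// (lt_trans ltr01).
apply: cvgey_pos => M M0.
have c20 : 0 < c / 2 by rewrite divr_gt0.
(* Young's inequality is applied to [t * w] and [1 / (t * m)]; this [t] makes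
   the second contribution smaller than [c / 2] when the sum is below [M]. *)
pose t := (M / (c / 2)) `^ q^-1.
have t0 : 0 < t by rewrite powR_gt0// divr_gt0.
have tp0 : 0 < t `^ p by rewrite powR_gt0.
have tqM : (t `^ q)^-1 * M = c / 2.
  rewrite -powRrM mulVf ?gt_eqF// powRr1 ?divr_ge0 ?ltW//.
  by rewrite invf_div -mulrA mulVf ?mulr1 ?gt_eqF.
(* Multiplied by [t ^ p], this bound on the mass is [c / 2], the share of the first contribution. *)
have e0 : 0 < (t `^ p)^-1 * (c / 2) by rewrite mulr_gt0 ?invr_gt0.
apply: filterS (fe _ e0) => j; rewrite massE => mass_lt.
rewrite leNgt; apply/negP => S_lt.
have := fc j; apply/negP; rewrite -ltNge.
apply: (@le_lt_trans _ _ (\esum_(u in Chin E (n j) v)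
   ((t `^ p * weighted mu f u `^ p)%:E + ((t `^ q)^-1 * (m u `^ q)^-1)%:E)%E)).
  apply: le_esum => u uS; rewrite -EFinD lee_fin fE.
  have -> : weighted mu f u * (m u)^-1 =
      (t * weighted mu f u) * ((t * m u)^-1).
    by rewrite invfM mulrACA divff ?gt_eqF// mul1r.
  have tw0 : 0 <= t * weighted mu f u by rewrite mulr_ge0 ?weighted_ge0// ltW.
  have tm0 : 0 <= t * m u by rewrite mulr_ge0 ?modulus_ge0// ltW.
  have itm0 : 0 <= (t * m u)^-1 by rewrite invr_ge0.
  apply: le_trans (Young_le tw0 itm0 p_gt1) _.
  rewrite -/q powRM ?weighted_ge0 ?(ltW t0)// lerD2l.
  rewrite -powR_inv1// powRAC powR_inv1 ?powR_ge0//.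
  by rewrite powRM ?modulus_ge0 ?(ltW t0)// invfM.
rewrite esumD; last 2 first.
- by move=> u _; rewrite lee_fin mulr_ge0 ?powR_ge0.
- by move=> u _; rewrite lee_fin mulr_ge0 ?invr_ge0 ?powR_ge0.
rewrite [ltRHS](_ : _ = (c / 2)%:E + (c / 2)%:E)%E;
  last by rewrite -EFinD -splitr.
apply: lteD.
  apply: le_lt_trans (le_esumZl _ (ltW tp0) _) _ => [u|]; first exact: powR_ge0.
  rewrite -[ltRHS](_ : (t `^ p)%:E * ((t `^ p)^-1 * (c / 2))%:E = _)%E.
    by rewrite lte_pmul2l.
  by rewrite -EFinM mulrA divff ?mul1r// gt_eqF.
apply: le_lt_trans (le_esumZl _ _ _) _ => [|u|]; rewrite ?invr_ge0 ?powR_ge0//.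
by rewrite -tqM EFinM lte_pmul2l// lte_fin invr_gt0 powR_gt0.
Qed.


Let mass_fin (F : {fset V}) (a : V -> R) (e : R) : 0 < e ->
    (forall u, 0 <= a u) -> (forall u, u \notin F -> a u = 0) ->
    match X with
    | ell p _ => (\sum_(u <- F) a u `^ p < e : Prop)
    | czero => forall u, a u <= e / 2
    end ->
  (mass X a < e%:E)%E.
Proof.
move=> e0 a0 aF; case: X => [p p1|] ae.
  have -> : a = a \_ [set` F].
    apply/funext => u; rewrite patchE; case: ifPn => // uF; apply: aF.
    by apply: contra uF => uF; rewrite inE.
  rewrite patch_esum esum_fset//; last first.
    by move=> u _; rewrite lee_fin powR_ge0.
  by rewrite fsbig_finite//= set_fsetK sumEFin lte_fin ae.
rewrite (@le_lt_trans _ _ (e / 2)%:E) ?lte_fin ?ltr_pdivrMr ?ltr_pMr ?ltr1n//.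
by apply: ge_ereal_sup => _ [u _ <-]; rewrite lee_fin ae.
Qed.

(** The vector [phi] is the extremal vector of Hölder's inequality, cut to a finite set and
    normalised: proportional to [1 / m] for [czero], to [m ^ -q] for [p > 1], and a point mass at a
    vertex of small weight for [p = 1]. *)
Lemma weight_conditionE v (n : nat -> nat) : weight_condition X E mu v n ->
  forall e : R, 0 < e -> \forall j \near \oo, exists (F : {fset V}) (phi : V ->
    R),
    [/\ [set` F] `<=` Chin E (n j) v,
        forall u, 0 <= phi u,
        forall u, u \notin F -> phi u = 0,
        \sum_(u <- F) phi u = 1 &
        (mass X (fun u => (phi u * m u)%R) < e%:E)%E].
Proof.
have m0 u : 0 < m u by rewrite modulus_gt0.
have normalize (w : V -> R) S M : 0 < M -> (forall u, 0 < w u) ->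
    (M%:E < \esum_(u in S) (w u)%:E)%E -> exists (F : {fset V}) (phi : V -> R),
    [/\ [set` F] `<=` S, forall u, 0 <= phi u,
        forall u, u \notin F -> phi u = 0,
        \sum_(u <- F) phi u = 1 &
        exists T, [/\ M < T, T = \sum_(u <- F) w u &
          forall u, u \in F -> phi u = w u / T]].
  move=> M0 w0 /ereal_sup_gt[_ [F [finF FS] <-]].
  rewrite fsbig_finite//= sumEFin lte_fin => MT.
  set T := \sum_(_ <- _) _ in MT.
  have T0 : 0 < T by exact: lt_trans MT.
  exists (fset_set F), (fun u => if u \in fset_set F then w u / T else 0).
  split.
  - by rewrite fset_setK.
  - by move=> u; case: ifP => // _; rewrite divr_ge0// ltW.
  - by move=> u /negPf ->.
  - rewrite big_seq (eq_bigr (fun u => w u / T)) => [|u ->//].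
    by rewrite -big_seq -mulr_suml divff// gt_eqF.
  - by exists T; split=> // u ->.
have mass_lt := @mass_fin.
rewrite /weight_condition; move: mass_lt; case: X => [p p1|] mass_lt;
  last first.
  (* On [F] the product [phi u * m u] is the constant [1 / T], and [T] exceeds [2 / e]. *)
  move=> /cvgeyPgt cvS e e0; have e20 : 0 < (e / 2)^-1 by rewrite invr_gt0
    divr_gt0.
  apply: filterS (cvS (e / 2)^-1) => j.
  case/(normalize _ _ _ e20) => [u|F [phi [FS phi0 phiF phi1 [T [MT _ phiE]]]]].
    by rewrite invr_gt0.
  exists F, phi; split=> //; apply: (mass_lt F) => // [u|u /phiF ->|u].
  - by rewrite mulr_ge0// ltW.
  - by rewrite mul0r.
  have [uF|/phiF ->] := boolP (u \in F); last by rewrite mul0r divr_ge0// ltW.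
  rewrite phiE// mulrAC mulVf ?gt_eqF// mul1r invf_ple ?posrE ?divr_gt0//.
    exact: ltW.
  exact: lt_trans MT.
case: ifPn => [/eqP p_eq1|p_neq1].
  move=> /cvge0P cvI e e0; have {}/cvI : 0 < e by [].
  have inf0 j : (0 <= ereal_inf [set (m u)%:E | u in Chin E (n j) v])%E.
    by apply: le_ereal_inf_tmp => _ [u _ <-]; rewrite lee_fin modulus_ge0.
  move=> /(_ inf0); apply: filterS => j /ereal_inf_lt[_ [u uS <-]].
  rewrite lte_fin => mu_lt; exists [fset u]%fset, (fun w => (w == u)%:R).
  split=> //.
  - by move=> w /=; rewrite inE => /eqP ->.
  - by move=> w; rewrite inE => /negPf ->.
  - by rewrite big_seq_fset1 eqxx.
  apply: (mass_lt [fset u]%fset) => // [w|w|].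
  - by rewrite mulr_ge0// ltW.
  - by rewrite inE => /negPf ->; rewrite mul0r.
  by rewrite big_seq_fset1 eqxx mul1r p_eq1 powRr1// ltW.
have {}p_gt1 : 1 < p by rewrite lt_def p_neq1.
have p0 : 0 < p by exact: lt_trans p_gt1.
have p10 : 0 < p - 1 by rewrite subr_gt0.
set q := p / (p - 1) => /cvgeyPgt cvS e e0.
(* For [phi = m ^ -q / T] the identity [(q - 1) * p = q] gives mass [T ^ (1 - p)], and [M] solves
   [M ^ (1 - p) = e]. *)
pose M := e^-1 `^ (p - 1)^-1.
have M0 : 0 < M by rewrite powR_gt0// invr_gt0.
apply: filterS (cvS M) => j.
case/(normalize _ _ _ M0) => [u|F [phi [FS phi0 phiF phi1 [T [MT TE phiE]]]]].
  by rewrite invr_gt0 powR_gt0.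
have T0 : 0 < T by exact: lt_trans MT.
exists F, phi; split=> //; apply: (mass_lt F) => // [u|u /phiF ->|].
- by rewrite mulr_ge0// ltW.
- by rewrite mul0r.
rewrite big_seq (eq_bigr (fun u => (m u `^ q)^-1 * (T `^ p)^-1)).
  rewrite -big_seq -mulr_suml -TE -(mulr_powRB1 (ltW T0) p0) invfM mulrA divff
    ?gt_eqF//.
  rewrite mul1r invf_plt ?posrE ?powR_gt0//.
  rewrite -[ltLHS](_ : M `^ (p - 1) = _).
    by apply: gt0_ltr_powR; rewrite ?nnegrE ?ltW.
  by rewrite -powRrM mulVf ?gt_eqF// powRr1// invr_ge0 ltW.
move=> u uF; rewrite phiE// mulrAC powRM ?invr_ge0 ?(ltW T0)//; last first.
  by rewrite mulr_ge0 ?invr_ge0 ?powR_ge0// ltW.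
congr (_ * _); last by rewrite -(powR_inv1 (ltW T0)) powRAC powR_inv1 ?powR_ge0.
rewrite -powRN -{2}[m u]powRr1 ?(ltW (m0 u))// -powRD;
  last by rewrite modulus_eq0 mu_weight implybT.
rewrite -powRrM; congr (_ `^ _).
have qp : q * (p - 1) = p by rewrite /q divfK// gt_eqF.
by rewrite mulrDl mul1r -{2}qp mulrBr mulr1 mulNr addrA addNr add0r.
Qed.

End WeightCondition.

(** * From a limit point of the orbit to the weight condition *)

Lemma near_neq {T : Type} (s : nat -> T) (i : nat) (x : T) :
    (forall a b, (i <= a)%N -> (a < b)%N -> s a <> s b) ->
  \forall j \near \oo, s j <> x.
Proof.
move=> s_inj; have [[a ia sa]|no] := pselect (exists2 a, (i <= a)%N & s a = x).
  by exists a.+1 => // j /= aj; rewrite -sa => /esym; exact: s_inj.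
by exists i => // j /= ij sj; apply: no; exists j.
Qed.

Section LimitPoint.
Context {R : realType} {k : scalar_kind} {V : countType}.
Context {E : rel V} {mu : V -> scalar R k} {X : space_kind R}.
Hypotheses (treeE : directed_tree E) (unrootedE : unrooted E).
Hypotheses (mu_weight : weight mu) (B_bounded : shift_bounded X E mu).
Local Notation B := (shift E).
Local Notation orb f n := (iter n B f).

Lemma weighted_lt (f : V -> scalar R k) v (e : R) : 0 < e ->
  (space_norm X mu f < e%:E)%E -> weighted mu f v < e.
Proof.
move=> e0; rewrite ltr_space_norm// => fe.
rewrite -(ltr_gaugeP X) ?weighted_ge0 ?ltW// -lte_fin.
by apply: le_lt_trans fe; apply: gauge_le_mass => u; exact: weighted_ge0.
Qed.

(** Each of the finitely many orbit elements other than [g] differs from [g] at some coordinate,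
    whose weighted difference bounds the norm from below. *)
Lemma orbit_avoid (f g : V -> scalar R k) (M : nat) : exists2 e : R, 0 < e &
  forall n, (n <= M)%N -> (space_norm X mu (orb f n - g)%R < e%:E)%E ->
    orb f n = g.
Proof.
have sep (h : V -> scalar R k) : exists2 e : R, 0 < e &
    (space_norm X mu (h - g)%R < e%:E)%E -> h = g.
  have [->|/eqP hg] := pselect (h = g); first by exists 1.
  have [v hgv] : exists v, h v != g v.
    apply: contrapT => hgN; case/negP: hg; apply/eqP/funext => v.
    by apply/eqP/negP => hgv; apply: hgN; exists v; apply/negP.
  have w0 : 0 < weighted mu (h - g)%R v.
    by rewrite modulus_gt0 mulf_neq0// subr_eq0.
  by exists (weighted mu (h - g)%R v) => // /(weighted_lt v w0); rewrite ltxx.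
elim: M => [|M [e e0 He]].
  have [e e0 He] := sep f; exists e => // n; rewrite leqn0 => /eqP ->.
  exact: He.
have [e' e'0 He'] := sep (orb f M.+1).
exists (Num.min e e') => [|n]; first by rewrite lt_min e0.
rewrite EFin_min lt_min leq_eqVlt => /orP[/eqP -> /andP[_]|nM /andP[+ _]].
  exact: He'.
exact: He.
Qed.

(** An accumulation point is approached by elements other than [g]; a radius below that of
    [orbit_avoid] rules out all indices up to [M]. *)
Lemma limit_point_seq (f g : V -> scalar R k) (M : nat) (e : R) : 0 < e ->
    accumulation_point X mu (orbit E f) g ->
  exists2 n, (M < n)%N & (space_norm X mu (orb f n - g)%R < e%:E)%E.
Proof.
move=> e0 [_ acc]; have [e' e'0 He'] := orbit_avoid f g M.
have [|h [hg [n _ nh] hge]] := acc (Num.min e e'); first by rewrite lt_min e0.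
move: hge; rewrite EFin_min lt_min -nh => /andP[ne ne'].
exists n => //; rewrite ltnNge; apply/negP => /He' /(_ ne').
by rewrite nh.
Qed.

Lemma limit_point_weight_condition (f g : V -> scalar R k) :
    in_space X mu f -> nonnegative f -> g <> 0 ->
    accumulation_point X mu (orbit E f) g ->
  exists (n : nat -> nat) (v : V),
    [/\ {homo n : i j / (i < j)%N},
        forall j, (0 < n j)%N,
        weight_condition X E mu v n &
        forall i, mu (iter (n j - n i)%N (par E) v)
          @[j --> \oo] --> (0 : scalar R k)].
Proof.
move=> fX f0 g_neq0 acc; have [gX _] := acc.
have [v gv] : exists v, g v != 0.
  apply: contrapT => gN; apply: g_neq0; apply/funext => v.
  by apply/eqP/negP => gv; apply: gN; exists v; apply/negP.
pose c := modulus (g v) / 2.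
have c0 : 0 < c by rewrite divr_gt0// modulus_gt0.
have mu0 u : 0 < modulus (mu u) by rewrite modulus_gt0.
(* The first entry keeps the value at [v] within [c], half the modulus of [g v], of [g v]; the
   second lets the error tend to 0. *)
pose e j : R := Num.min (c * modulus (mu v)) j.+1%:R^-1.
have e0 j : 0 < e j by rewrite lt_min mulr_gt0//= invr_gt0.
have /choice[s sP] (Mj : nat * nat) : exists n, (Mj.1 < n)%N /\
    (space_norm X mu (orb f n - g)%R < (e Mj.2)%:E)%E.
  by have [n ? ?] := limit_point_seq Mj.1 (e0 Mj.2) acc; exists n.
(* The arguments of [s] are the last index and the rank of the next tolerance; starting above 0
   makes [n 0] positive. *)
pose n := fix n j := if j is i.+1 then s (n i, i.+1) else s (0, 0)%N.
have n_mono : {homo n : i j / (i < j)%N}.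
  apply: homo_ltn => [y x z|j]; first exact: ltn_trans.
  exact: (sP (n j, j.+1)).1.
have n_gt0 j : (0 < n j)%N.
  by case: j => [|j]; [|apply: leq_ltn_trans (leq0n (n j)) _];
    [exact: (sP (0, 0)%N).1|exact: (sP (n j, j.+1)).1].
have nP j u : weighted mu (orb f (n j) - g)%R u < e j.
  by apply: weighted_lt => //; case: j => [|j]; exact: (sP (_, _)).2.
have orb_ge j : c <= modulus (orb f (n j) v).
  have : modulus (orb f (n j) v - g v) < c.
    have := nP j v; rewrite /weighted modulusM lt_min ltr_pM2r//.
    by case/andP.
  rewrite modulusB => dc; have := ler_modulusB (g v) (orb f (n j) v).
  move=> /le_lt_trans/(_ dc); rewrite ltrBlDl -ltrBlDr => /ltW.
  by rewrite /c {1}[modulus (g v)]splitr addrK.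
exists n, v; split=> //.
  have fc j : (c%:E <= \esum_(u in Chin E (n j) v) (modulus (f u))%:E)%E.
    by rewrite -(iter_shift_sum treeE unrootedE B_bounded (n j) fX f0).2
      lee_fin.
  apply: (weight_conditionI mu_weight c0 fc).
  (* A given [u] lies in [Chin E (n j) v] for at most one [j]. *)
  apply: mass_tail => // u.
  suff : \forall j \near \oo, iter (n j) (par E) u <> v.
    by apply: filterS => j; rewrite ChinE.
  apply: (near_neq (i := 0%N)) => a b _ /n_mono ab.
  by move=> /(iter_par_inj treeE unrootedE) nab; rewrite nab ltnn in ab.
move=> i; apply/cvg_modulusP => d d0.
have cd0 : 0 < c * d / 2 by rewrite divr_gt0// mulr_gt0.
pose w j := iter (n j - n i) (par E) v.
(* For [j < i] truncated subtraction gives [w j = v]; the vertices [w j] are distinct only from [i]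
   on. *)
have w_neq u : \forall j \near \oo, ~ [set w j] u.
  apply: filterS (near_neq (s := w) (i := i) u _) => [j wj /= uw|].
    exact/wj/esym.
  move=> a b ia ab /(iter_par_inj treeE unrootedE).
  have nia : (n i <= n a)%N.
    by move: ia; rewrite leq_eqVlt => /predU1P[->//|/n_mono/ltnW].
  by move=> nab; have := ltn_sub2r (leq_ltn_trans nia (n_mono _ _ ab)) (n_mono
    _ _ ab);
    rewrite nab ltnn.
near=> j.
have ij : (i <= j)%N by near: j; exact: nbhs_infty_ge.
have nij : (n i <= n j)%N.
  by move: ij; rewrite leq_eqVlt => /predU1P[->//|/n_mono/ltnW].
have g_small : weighted mu g (w j) < c * d / 2.
  rewrite -(ltr_gaugeP X) ?weighted_ge0 ?ltW// -lte_fin.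
  apply: (@le_lt_trans _ _ (mass X (weighted mu g \_ [set w j]))); last first.
    by near: j; exact: (mass_tail gX w_neq (gauge_gt0 X cd0)).
  have := gauge_le_mass X (w j) (a := weighted mu g \_ [set w j]).
  rewrite patchE ifT; last by rewrite inE.
  by apply=> u; rewrite patchE; case: ifP => // _; exact: weighted_ge0.
have d_small : weighted mu (orb f (n j) - g)%R (w j) < c * d / 2.
  apply: lt_trans (nP _ _) _; rewrite /e gt_min; apply/orP; right.
  by near: j; exact: (near_infty_natSinv_lt (PosNum cd0)).
(* The product of [c] and the weight at [w j] is at most the weighted value of [B^(n_j) f] there,
   hence at most those of the error and of [g] together, each below [c * d / 2]. *)
rewrite sub0r modulusN -(ltr_pM2l c0).
apply: (@le_lt_trans _ _ (weighted mu (orb f (n j)) (w j))).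
  rewrite /weighted modulusM ler_pM2r//.
  apply: le_trans (orb_ge i) _.
  have := iter_shift_ge treeE unrootedE B_bounded (n j - n i) (n i) v fX f0.
  by rewrite subnK.
rewrite [ltRHS]splitr; apply: le_lt_trans (ltrD d_small g_small).
rewrite /weighted -{1}(subrK (g (w j)) (orb f (n j) (w j))) mulrDl.
exact: ler_modulusD.
Unshelve. all: by end_near. Qed.

End LimitPoint.

(** * Indicators, growth under iteration and choice of a fast subsequence *)

Lemma mass_delta {R : realType} {V : choiceType} (X : space_kind R) (u : V) (c
  : R) :
  0 <= c -> (mass X (fun w => ((w == u)%:R * c)%R) <= (gauge X c)%:E)%E.
Proof.
move=> c0; rewrite /mass; case: X => [p p1|].
  rewrite -(@esum_set1 _ _ u (fun=> (gauge (ell p1) c)%:E)); last first.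
    by rewrite lee_fin gauge_ge0.
  rewrite [leRHS]esum_mkcond; apply: le_esum => w _.
  have [->|wu] := eqVneq w u; first by rewrite mul1r ifT// inE.
  by rewrite mul0r gauge0 ifF//; apply/negbTE; rewrite notin_setE => /=
    /eqP/negPn; rewrite wu.
apply: ge_ereal_sup => _ [w _ <-]; rewrite lee_fin ler_gauge ?mulr_ge0//.
by rewrite ler_piMl// lern1 leq_b1.
Qed.

Lemma indic_set1E {T : eqType} {K : pzRingType} (v u : T) :
  \1_[set v] u = (u == v)%:R :> K.
Proof.
rewrite indicE; congr (_%:R); congr nat_of_bool.
by apply/idP/eqP => [|->]; rewrite inE.
Qed.

Section Construction.
Context {R : realType} {k : scalar_kind} {V : countType}.
Context {E : rel V} {mu : V -> scalar R k} {X : space_kind R}.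
Hypotheses (treeE : directed_tree E) (unrootedE : unrooted E).
Hypotheses (mu_weight : weight mu) (B_bounded : shift_bounded X E mu).
Local Notation B := (shift E).
Local Notation m u := (modulus (mu u)).

Let m_gt0 u : 0 < m u.
Proof. by rewrite modulus_gt0. Qed.

Lemma in_space_le (f g : V -> scalar R k) :
    (forall u, weighted mu g u <= weighted mu f u) ->
  in_space X mu f -> in_space X mu g.
Proof.
move=> gf /in_spaceP fX; apply/in_spaceP => e /fX[F Fe]; exists F.
apply: le_lt_trans Fe; apply: le_mass => u; rewrite !patchE; case: ifP => // _.
exact: weighted_ge0.
Qed.

Lemma in_space_indic v : in_space X mu (\1_[set v] : V -> scalar R k).
Proof.
apply/in_spaceP => e e0; exists [fset v]%fset.
suff -> : weighted mu (\1_[set v] : V -> scalar R k) \_ (~` [set` [fset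
  v]%fset]) =
    (fun w => (w == v)%:R * 0).
  by apply: le_lt_trans (mass_delta X v (lexx 0)) _; rewrite gauge0 lte_fin.
apply/funext => u; rewrite patchE mulr0; case: ifPn => //.
rewrite inE /= inE => /negP/negbTE uv.
by rewrite /weighted indic_set1E uv mul0r modulus0.
Qed.

Lemma mass_iter_shift : exists2 C : R, 1 <= C &
  forall n f, in_space X mu f ->
    (mass X (weighted mu (iter n B f)) <= (C ^+ n)%:E * mass X (weighted mu
      f))%E.
Proof.
have [C C1 BC] := mass_shift B_bounded; exists C => // n f fX.
elim: n => [|n IH]; first by rewrite expr0 mul1e.
rewrite iterS; apply: le_trans (BC _ (in_space_iter_shift B_bounded n fX)) _.
by rewrite exprS EFinM -muleA lee_wpmul2l// lee_fin (le_trans ler01).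
Qed.

(* With these rates, the pieces [i < j] contribute at most [2^-j] to
   [B^(N j) f], and so do the pieces [i > j], where [C ^+ N j] bounds the
   growth of the mass under [B^(N j)]. *)
Lemma fast_subsequence (n : nat -> nat) (v : V) (C : R) : 1 <= C ->
    {homo n : i j / (i < j)%N} -> weight_condition X E mu v n ->
    (forall i, mu (iter (n j - n i)%N (par E) v)
       @[j --> \oo] --> (0 : scalar R k)) ->
  exists (N : nat -> nat) (F : nat -> {fset V}) (phi : nat -> V -> R),
    [/\ {homo N : i j / (i < j)%N},
        forall j, [/\ [set` F j] `<=` Chin E (N j) v,
          forall u, 0 <= phi j u,
          forall u, u \notin F j -> phi j u = 0 &
          \sum_(u <- F j) phi j u = 1],
        forall i j, (i < j)%N ->
          gauge X (m (iter (N j - N i) (par E) v)) <= ((4 ^ j.+1)%:R)^-1 &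
        forall i j, (i < j)%N ->
          (mass X (fun u => (phi j u * m u)%R) <=
            (((4 ^ j.+1)%:R * C ^+ N i)^-1)%:E)%E].
Proof.
move=> C1 n_mono wc mu0.
have C0 : 0 < C by exact: lt_le_trans C1.
have n_le i j : (i <= j)%N -> (n i <= n j)%N.
  by rewrite leq_eqVlt => /predU1P[->//|/n_mono/ltnW].
(* The first entry of [K] is the last index chosen, the second the rank of the next piece; as
   [1 <= C], the power [C ^+ n K.1] dominates those of all earlier indices. *)
pose d (K : nat * nat) : R := ((4 ^ K.2.+1)%:R * C ^+ n K.1)^-1.
have d0 K : 0 < d K by rewrite invr_gt0 mulr_gt0 ?exprn_gt0// ltr0n expn_gt0.
have : forall K : nat * nat, exists q : nat * ({fset V} * (V -> R)),
  [/\ (K.1 < q.1)%N,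
    forall i, (i <= K.1)%N -> gauge X (m (iter (n q.1 - n i) (par E) v)) <= d K
      &
    [/\ [set` q.2.1] `<=` Chin E (n q.1) v,
        forall u, 0 <= q.2.2 u,
        forall u, u \notin q.2.1 -> q.2.2 u = 0,
        \sum_(u <- q.2.1) q.2.2 u = 1 &
        (mass X (fun u => (q.2.2 u * m u)%R) < (d K)%:E)%E]].
  move=> K; have [x x0 xd] := gauge_surj X (d0 K).
  have mu_small : \forall j \near \oo, forall i : 'I_K.1.+1,
      m (iter (n j - n i) (par E) v) < x.
    apply: filter_forall => i; have /cvg_modulusP/(_ _ x0) := mu0 i.
    by apply: filterS => j; rewrite sub0r modulusN.
  near \oo => j; have jK : (K.1 < j)%N by near: j; exact: nbhs_infty_gt.
  have [F [phi Fphi]] : exists (F : {fset V}) (phi : V -> R),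
    [/\ [set` F] `<=` Chin E (n j) v,
        forall u, 0 <= phi u,
        forall u, u \notin F -> phi u = 0,
        \sum_(u <- F) phi u = 1 &
        (mass X (fun u => (phi u * m u)%R) < (d K)%:E)%E].
    by near: j; exact: (weight_conditionE mu_weight wc (d0 K)).
  exists (j, (F, phi)); split=> // i iK; rewrite -xd ler_gauge ?modulus_ge0//
    ltW//.
  have : forall i : 'I_K.1.+1, m (iter (n j - n i) (par E) v) < x by near: j.
  by move/(_ (Ordinal (iK : (i < K.1.+1)%N))).
move=> /choice[s sP].
pose sigma := fix sigma j := if j is i.+1 then (s (sigma i, i.+1)).1 else (s
  (0, 0)%N).1.
(* The value at 0 only fixes the parameters of the first choice, which no piece precedes. *)
pose prev j := if j is i.+1 then sigma i else 0%N.
have sigmaE j : sigma j = (s (prev j, j)).1 by case: j.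
have sigma_mono : {homo sigma : i j / (i < j)%N}.
  apply: homo_ltn => [y x z|j]; first exact: ltn_trans.
  by have [] := sP (sigma j, j.+1).
have sigma_le i j : (i <= j)%N -> (sigma i <= sigma j)%N.
  by rewrite leq_eqVlt => /predU1P[->//|/sigma_mono/ltnW].
have prev_ge i j : (i < j)%N -> (sigma i <= prev j)%N.
  by case: j => // j; rewrite ltnS => /sigma_le.
have d_le j : d (prev j, j) <= ((4 ^ j.+1)%:R)^-1.
  by rewrite lef_pV2 ?posrE ?mulr_gt0 ?exprn_gt0 ?ltr0n ?expn_gt0// ler_peMr
    ?exprn_ege1.
exists (n \o sigma), (fun j => (s (prev j, j)).2.1), (fun j => (s (prev j,
  j)).2.2).
split.
- by move=> i j /sigma_mono/n_mono.
- by move=> j; have [_ _ [? ? ? ? _]] := sP (prev j, j); rewrite /= sigmaE.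
- move=> i j /prev_ge ij; apply: le_trans (d_le j).
  by have [_ + _] := sP (prev j, j); rewrite /= [sigma j]sigmaE; exact.
- move=> i j /prev_ge ij; have [_ _ [_ _ _ _ /ltW]] := sP (prev j, j).
  move/le_trans; apply; rewrite lee_fin.
  rewrite lef_pV2 ?posrE ?mulr_gt0 ?exprn_gt0 ?ltr0n ?expn_gt0//.
  rewrite ler_wpM2l// ler_weXn2l//; exact: n_le.
Unshelve. all: by end_near. Qed.

End Construction.

(** * Superposition of pieces with disjoint supports *)

Section DisjointPieces.
Context {R : realType} {V : countType}.
Variables (phi : nat -> V -> R).
Hypothesis phi0 : forall j u, 0 <= phi j u.
Hypothesis phi_disj : forall i j u, phi i u != 0 -> phi j u != 0 -> i = j.

(* If all [phi j u] vanish, the default [0] still yields [glued u = 0]. *)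
Definition glued u : R := phi (xget 0%N [set j | phi j u != 0]) u.

Definition glued_tail (l : nat) u : R := glued u - \sum_(j < l.+1) phi j u.

Lemma gluedE j u : phi j u != 0 -> glued u = phi j u.
Proof.
move=> ju; rewrite /glued; congr (phi _ u); apply: (phi_disj _ ju).
exact: (@xgetPex _ 0%N [set j | phi j u != 0] (ex_intro _ j ju)).
Qed.

Lemma glued_ge0 u : 0 <= glued u.
Proof. exact: phi0. Qed.

Lemma sum_disj l j u : phi j u != 0 ->
  \sum_(i < l.+1) phi i u = if (j <= l)%N then phi j u else 0.
Proof.
move=> ju; have phiN i : i != j -> phi i u = 0.
  by apply: contraNeq => /phi_disj/(_ ju) ->.
case: ifP => jl.
  rewrite (bigD1 (inord j)) //= inordK ?ltnS// big1 ?addr0// => i ij.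
  by apply: phiN; apply: contraNneq ij => <-; rewrite inord_val.
rewrite big1// => i _; apply: phiN; apply/eqP => ij.
by move: jl; rewrite -ij -ltnS ltn_ord.
Qed.

(** At most one piece is non-zero at each vertex. In this form the remainder meets the domination
    hypothesis of [mass_series]. *)
Lemma glued_tailP l u :
  glued_tail l u = 0 \/ exists2 j, (l < j)%N & glued_tail l u = phi j u.
Proof.
have [[j ju]|no] := pselect (exists j, phi j u != 0).
  rewrite /glued_tail (sum_disj _ ju) (gluedE ju).
  by case: leqP => lj; [left; rewrite subrr|right; exists j; rewrite ?subr0].
left; have phi_eq0 j : phi j u = 0.
  by apply/eqP/negPn/negP => ju; apply: no; exists j.
by rewrite /glued_tail /glued phi_eq0 big1 ?subr0// => i _.
Qed.

Lemma glued_tail_ge0 l u : 0 <= glued_tail l u.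
Proof. by have [->|[j _ ->]] := glued_tailP l u. Qed.

Lemma glued_tail_le l u : glued_tail l u <= glued u.
Proof. by rewrite lerBlDr lerDl sumr_ge0. Qed.

Lemma glued_split l u : glued u = \sum_(j < l.+1) phi j u + glued_tail l u.
Proof. by rewrite addrC subrK. Qed.

End DisjointPieces.

(** * From the weight condition to a vector whose orbit accumulates at an indicator *)

Section LimitVector.
Context {R : realType} {k : scalar_kind} {V : countType}.
Context {E : rel V} {mu : V -> scalar R k} {X : space_kind R}.
Hypotheses (treeE : directed_tree E) (unrootedE : unrooted E).
Hypotheses (mu_weight : weight mu) (B_bounded : shift_bounded X E mu).
Local Notation B := (shift E).
Local Notation m u := (modulus (mu u)).

Lemma limit_indicator (n : nat -> nat) (v : V) :
    {homo n : i j / (i < j)%N} -> weight_condition X E mu v n ->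
    (forall i, mu (iter (n j - n i)%N (par E) v)
       @[j --> \oo] --> (0 : scalar R k)) ->
  exists f : V -> scalar R k,
    [/\ in_space X mu f, nonnegative f, f <> 0 &
        accumulation_point X mu (orbit E f) \1_[set v]].
Proof.
move=> n_mono wc mu0; have [C C1 BC] := mass_iter_shift B_bounded.
have [N [F [phi [N_mono Fphi mu_small phi_small]]]] :=
  fast_subsequence mu_weight C1 n_mono wc mu0.
have C0 : 0 < C by exact: lt_le_trans C1.
have phi0 j u : 0 <= phi j u by have [_ + _ _] := Fphi j; exact.
have phi_gen j u : phi j u != 0 -> iter (N j) (par E) u = v.
  have [FC _ phiF _] := Fphi j.
  have [uF _|/phiF ->] := boolP (u \in F j); last by rewrite eqxx.
  by have := FC _ uF; rewrite ChinE.
have N_inj : injective N.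
  by move=> i j ij; case: (ltngtP i j) => // /N_mono; rewrite ij ltnn.
(* A vertex in both supports would have [v] as its ancestor at distances [N i] and [N j]. *)
have phi_disj i j u : phi i u != 0 -> phi j u != 0 -> i = j.
  move=> /phi_gen iu /phi_gen; rewrite -iu => ij.
  exact/N_inj/esym/(iter_par_inj treeE unrootedE ij).
have gl0 u := glued_ge0 phi0 u.
have tl0 l u := glued_tail_ge0 phi0 phi_disj l u.
pose f u : scalar R k := of_real (glued phi u).
pose r l u : scalar R k := of_real (glued_tail phi l u).
have fm u : weighted mu f u = glued phi u * m u.
  by rewrite /weighted modulusM modulus_of_real ger0_norm.
have rm l u : weighted mu (r l) u = glued_tail phi l u * m u.
  by rewrite /weighted modulusM modulus_of_real ger0_norm.
have r_small l : (mass X (weighted mu (r l)) <= ((2 ^ l)%:R * C ^+ N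
  l)^-1%:E)%E.
  have D0 : 0 < (2 ^ l)%:R * C ^+ N l.
    by rewrite mulr_gt0 ?exprn_gt0// ltr0n expn_gt0.
  (* The remainder past [l] consists of the pieces [l + i + 1], and [4 ^ (l + i + 2)] is at least
     [2 ^ l * 2 ^ (i + 1)]. *)
  apply: (mass_series (b := fun i u => phi (l + i.+1)%N u * m u)).
  - by rewrite invr_ge0 ltW.
  - exact: weighted_ge0.
  - by move=> i u; rewrite mulr_ge0// modulus_ge0.
  - move=> u; rewrite rm; have [->|[j lj ->]] := glued_tailP phi_disj l u.
      by left; rewrite mul0r.
    by right; exists (j - l.+1)%N; rewrite addnS -addSn subnKC.
  move=> i; apply: le_trans (phi_small l _ _) _;
    first by rewrite addnS ltnS leq_addr.
  rewrite lee_fin -invfM lef_pV2 ?posrE ?mulr_gt0 ?exprn_gt0 ?ltr0n ?expn_gt0//.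
  rewrite mulrAC ler_wpM2r ?exprn_ge0 ?(ltW C0)// -natrM ler_nat -expnD.
  by rewrite (@leq_trans (2 ^ (l + i.+1).+1)%N) ?leq_exp2l// leq_exp2r.
have half_small (e : R) : 0 < e -> exists l, ((2 ^ l)%:R)^-1 < e.
  move=> e0; have [l _ le] := near_infty_natSinv_expn_lt (PosNum e0).
  by exists l; rewrite natrX -div1r; exact: (le l (leqnn l)).
have r_lt l : ((2 ^ l)%:R * C ^+ N l)^-1 <= ((2 ^ l)%:R)^-1.
  by rewrite lef_pV2 ?posrE ?mulr_gt0 ?exprn_gt0 ?ltr0n ?expn_gt0// ler_peMr
    ?exprn_ege1.
have fX : in_space X mu f.
  apply/in_spaceP => e /half_small[l le].
  (* Outside the finite union of the sets [F j] with [j <= l], the vector [f] coincides with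
     [r l]. *)
  exists (fset_set (\bigcup_(j < l.+1) [set` F j])).
  rewrite fset_setK; last by apply: bigcup_finite => // j _; exact: finite_fset.
  have : (mass X (weighted mu (r l)) < e%:E)%E.
    by apply: le_lt_trans (r_small l) _; rewrite lte_fin (le_lt_trans (r_lt l)).
  apply: le_lt_trans; apply: le_mass => u.
    by rewrite patchE; case: ifP => // _; exact: weighted_ge0.
  rewrite patchE; case: ifPn => [|_]; last exact: weighted_ge0.
  rewrite inE => uF; rewrite fm rm /glued_tail big1 ?subr0// => j _.
  have [_ _ phiF _] := Fphi j; apply: phiF; apply/negP => uFj; apply: uF.
  by exists j => //=.
have rX l : in_space X mu (r l).
  apply: in_space_le fX => u; rewrite fm rm ler_wpM2r ?modulus_ge0//.
  exact: glued_tail_le.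
have of_real_ge0 (x : R) : 0 <= x -> 0 <= of_real x :> scalar R k.
  by move=> x0; rewrite -of_real0 ler_of_real.
have f0 : nonnegative f by move=> u; exact: of_real_ge0.
have r0 l : nonnegative (r l) by move=> u; exact: of_real_ge0.
have phi_pos j : exists u, phi j u != 0.
  apply: contrapT => no; have [_ _ _] := Fphi j.
  rewrite big1 => [/esym/eqP|u _]; first by rewrite oner_eq0.
  by apply/eqP/negPn/negP => ju; apply: no; exists u.
have f_neq0 j u : phi j u != 0 -> f u != 0.
  by move=> ju; rewrite -modulus_eq0 modulus_of_real normr_eq0 (gluedE phi_disj
    ju).
pose w l j := iter (N l - N j) (par E) v.
(* All vertices where [phi j] is non-zero share the ancestor [w l j] at distance [N l], so the total
   1 is collected there and nothing elsewhere. *)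
have phi_sum l j u : (j <= l)%N ->
    (\esum_(x in Chin E (N l) u) (phi j x)%:E = ((u == w l j)%:R)%:E)%E.
  move=> jl; have Njl : (N j <= N l)%N.
    by move: jl; rewrite leq_eqVlt => /predU1P[->//|/N_mono/ltnW].
  have phi_w x : phi j x != 0 -> iter (N l) (par E) x = w l j.
    by move=> /phi_gen jx; rewrite /w -jx -iterD subnK.
  have [uw|uw] := eqVneq u (w l j); last first.
    rewrite esum1// => x; rewrite ChinE//= => xu; congr (_%:E).
    by apply: contraNeq uw => /phi_w <-; rewrite xu.
  rewrite esum_mkcond (_ : 1%:R%:E = \sum_(x \in [set` F j]) (phi j x)%:E)%E;
    last first.
    by rewrite fsbig_finite//= set_fsetK sumEFin; have [_ _ _ ->] := Fphi j.
  rewrite -esum_fset//; last by move=> x _; rewrite lee_fin.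
  rewrite [RHS]esum_mkcond; apply: eq_esum => x _.
  have [->|jx] := eqVneq (phi j x) 0; first by rewrite !if_same.
  rewrite ifT; last by rewrite inE ChinE//= uw phi_w.
  rewrite ifT// inE /=; have [_ _ phiF _] := Fphi j.
  by apply: contraNT jx => /phiF ->.
have w_self l : w l l = v by rewrite /w subnn.
(* All terms being non-negative, the splitting of [f] into pieces and remainder passes to the sums
   over [Chin E (N l) u], with no appeal to linearity of the shift. *)
have orbitE l u : iter (N l) B f u =
    of_real (\sum_(j < l) (u == w l j)%:R + (u == v)%:R +
             modulus (iter (N l) B (r l) u)).
  have [Bf0 BfE] := iter_shift_sum treeE unrootedE B_bounded (N l) fX f0.
  have [_ BrE] := iter_shift_sum treeE unrootedE B_bounded (N l) (rX l) (r0 l).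
  rewrite -[LHS]of_real_modulus_ge0//; congr of_real; apply: EFin_inj.
  rewrite BfE EFinD BrE -(w_self l).
  rewrite -(big_ord_recr l (fun j => (u == w l j)%:R)) -sumEFin.
  under [X in (X + _)%E]eq_bigr => j _ do rewrite -(phi_sum l j u (ltn_ord j)).
  rewrite -esum_sum; last by move=> x j _ _; rewrite lee_fin.
  rewrite -esumD; last 2 first.
  - by move=> x _; rewrite sumEFin lee_fin sumr_ge0.
  - by move=> x _; rewrite lee_fin modulus_ge0.
  apply: eq_esum => x _; rewrite sumEFin -EFinD !modulus_of_real !ger0_norm//.
  by rewrite -glued_split.
exists f; split=> //.
  have [u /f_neq0 fu] := phi_pos 0%N; move=> f_eq0.
  by move: fu; rewrite f_eq0 eqxx.
split=> [|e e0]; first exact: in_space_indic.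
(* [massD] costs [gauge X 2], and each of the two contributions will have mass at most [2 ^ -l]. *)
have ge0 : 0 < gauge X e / gauge X 2 / 2.
  by rewrite !divr_gt0// gauge_gt0.
have [l le] := half_small _ ge0.
exists (iter (N l) B f); split; last 2 first.
- by exists (N l).
- rewrite ltr_space_norm//.
  pose a u := (\sum_(j < l) (u == w l j)%:R) * m u.
  have a0 u : 0 <= a u by rewrite mulr_ge0 ?modulus_ge0// sumr_ge0.
  have a_small : (mass X a <= ((2 ^ l)%:R)^-1%:E)%E.
    (* The vertices [w l j] with [j < l] are distinct, so [a] has at most one term at each vertex;
       [4 ^ -(l + 1)] is at most [2 ^ -l * 2 ^ -(j + 1)]. *)
    apply: (mass_series (b := fun j u => if (j < l)%N then (u == w l j)%:R * m
      (w l j) else 0)) => //.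
    + by move=> j u; case: ifP => // _; rewrite mulr_ge0// modulus_ge0.
    + move=> u; have [[j uj]|no] := pselect (exists j : 'I_l, u = w l j).
        right; exists j; rewrite ltn_ord -uj eqxx mul1r /a (bigD1 j)//= big1.
          by rewrite addr0 -uj eqxx mul1r.
        move=> i ij; have [uwi|//] := eqVneq u (w l i).
        have Nl (h : 'I_l) : (N h <= N l)%N by exact/ltnW/N_mono.
        case/eqP: ij; apply/val_inj/N_inj; rewrite -(subKn (Nl i)) -(subKn (Nl
          j)).
        by congr (_ - _)%N; apply: (iter_par_inj treeE unrootedE (v := v));
          rewrite -/(w l i) -uwi.
      left; rewrite /a big1 ?mul0r// => j _; have [uw|//] := eqVneq u (w l j).
      by case: no; exists j.
    move=> j; have [jl|lj] := ltnP j l.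
      apply: le_trans (mass_delta _ _ _) _; first exact: modulus_ge0.
      rewrite lee_fin (le_trans (mu_small _ _ jl))// -invfM lef_pV2 ?posrE
        ?mulr_gt0 ?ltr0n ?expn_gt0//.
      rewrite -natrM ler_nat -expnD (@leq_trans (2 ^ (l.+1 + l.+1))%N)//.
        by rewrite leq_exp2l// leq_add//; exact: ltnW.
      by rewrite expnD -expnMn.
    apply: (@le_trans _ _ 0%E); last by rewrite lee_fin divr_ge0 ?invr_ge0.
    have := mass_delta X v (lexx (0 : R)); rewrite gauge0.
    by under eq_fun do rewrite mulr0.
  have b_small : (mass X (weighted mu (iter (N l) B (r l))) <= ((2 ^
    l)%:R)^-1%:E)%E.
    apply: le_trans (BC _ _ (rX l)) _.
    apply: (@le_trans _ _ ((C ^+ N l)%:E * ((2 ^ l)%:R * C ^+ N l)^-1%:E)%E).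
      by rewrite lee_wpmul2l// lee_fin exprn_ge0// ltW.
    by rewrite -EFinM lee_fin invfM mulrCA divff ?mulr1// expf_neq0// gt_eqF.
  have -> : weighted mu (iter (N l) B f - \1_[set v])%R =
      (fun u => a u + weighted mu (iter (N l) B (r l)) u)%R.
    apply/funext => u; rewrite {1}/weighted -[(_ - _) u]/(_ u - _ u) orbitE
      indic_set1E.
    have -> : (u == v)%:R = of_real (u == v)%:R :> scalar R k.
      by case: (u == v); rewrite ?of_real1 ?of_real0.
    rewrite -of_realB addrAC addrK modulusM modulus_of_real ger0_norm;
      last first.
      by rewrite addr_ge0 ?modulus_ge0// sumr_ge0.
    by rewrite mulrDl /weighted modulusM.
  apply: le_lt_trans (massD X a0 _) _; first exact: weighted_ge0.
  apply: (@le_lt_trans _ _ ((gauge X 2)%:E * (((2 ^ l)%:R)^-1%:E + ((2 ^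
    l)%:R)^-1%:E))%E).
    by rewrite lee_wpmul2l ?lee_fin ?gauge_ge0// leeD.
  rewrite -EFinD -EFinM lte_fin -mulr2n -[X in _ * X]mulr_natr mulrC.
  by rewrite -ltr_pdivlMr ?gauge_gt0// -ltr_pdivlMr.
(* It remains to see that this orbit element is not the indicator itself: the piece [l + 1] makes it
   non-zero at [iter (N l) (par E) u], which is not [v] because [u] reaches [v] only after [N l.+1]
   steps. *)
have [u ju] := phi_pos l.+1.
move=> /(congr1 (fun h => h (iter (N l) (par E) u))).
rewrite indic_set1E; case: eqVneq => [uv|_] /eqP.
  have := iter_par_inj treeE unrootedE (etrans uv (esym (phi_gen _ _ ju))).
  by move=> /N_inj/eqP; rewrite ltn_eqF.
rewrite -modulus_eq0 eq_le leNgt => /andP[/negP + _]; apply.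
have := iter_shift_ge treeE unrootedE B_bounded (N l) 0 u fX f0.
rewrite addn0; apply: lt_le_trans; rewrite modulus_gt0; exact: f_neq0 ju.
Qed.

End LimitVector.

Theorem proposition7p3 (R : realType) (k : scalar_kind) (V : countType)
    (E : rel V) (mu : V -> scalar R k) (X : space_kind R)
    (treeE : directed_tree E) (unrootedE : unrooted E) (mu_weight : weight mu)
    (B_bounded : shift_bounded X E mu) :
  [<-> exists f g : V -> scalar R k,
         [/\ in_space X mu f, nonnegative f, f <> 0, g <> 0 &
             accumulation_point X mu (orbit E f) g];
       exists (v : V) (f : V -> scalar R k),
         [/\ in_space X mu f, nonnegative f, f <> 0 &
             accumulation_point X mu (orbit E f) \1_[set v]];
       exists (n : nat -> nat) (v : V),
         [/\ {homo n : i j / (i < j)%N},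
             forall j, (0 < n j)%N,
             weight_condition X E mu v n &
             forall i, mu (iter (n j - n i)%N (par E) v)
               @[j --> \oo] --> (0 : scalar R k)]].
Proof.
have indic_neq0 (v : V) : (\1_[set v] : V -> scalar R k) <> 0.
  by move=> /(congr1 (@^~ v))/eqP; rewrite indic_set1E eqxx oner_eq0.
(* The first implication passes through the weight condition: a limit point [g] yields [v], for
   which a new vector [f] is built. *)
split=> [[f [g [fX f0 _ g_neq0 acc]]]|].
  have [n [v [n_mono _ wc mu0]]] :=
    limit_point_weight_condition treeE unrootedE mu_weight B_bounded fX f0
      g_neq0 acc.
  by exists v; exact: (limit_indicator treeE unrootedE mu_weight B_bounded
    n_mono).
split=> [[v [f [fX f0 _ acc]]]|[n [v [n_mono _ wc mu0]]]].
  exact: (limit_point_weight_condition treeE unrootedE mu_weight B_bounded fX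
    f0 _ acc).
have [f [fX f0 f_neq0 acc]] :=
  limit_indicator treeE unrootedE mu_weight B_bounded n_mono wc mu0.
by exists f, \1_[set v]; split.
Qed.
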